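(* For every $\varepsilon\in(0,1)$ and $\delta:=\min\{\varepsilon/5,1/2\}$, given access to a $(1+\delta)$-gap $\mathrm{CVP}_\infty$ oracle, one can compute a $(1+\varepsilon)$-approximation for $\mathrm{CVP}_\infty$ on an instance $(A,t)$ in dimension $n$ with encoding length $b$ using $O(\log b+\log n+\log 1/\varepsilon)$ calls to the oracle.
   Context: For $A\in\mathbb{Q}^{n\times n}$, $\Lambda(A)=\{Ax:x\in\mathbb{Z}^n\}$. $\mathrm{CVP}_\infty$: given $A$ and $t\in\mathbb{Q}^n$, find $v\in\Lambda(A)$ minimizing $\|v-t\|_\infty$; a $(1+\varepsilon)$-approximation is a $v\in\Lambda(A)$ with $\|v-t\|_\infty\le(1+\varepsilon)\min_{w\in\Lambda(A)}\|w-t\|_\infty$. For $\alpha\ge1$, the $\alpha$-gap $\mathrm{CVP}_\infty$ problem is: given $\Lambda(A)$, $t$ and $D>0$, either find $v\in\Lambda(A)$ with $\|v-t\|_\infty\le D$, or assert that all $v\in\Lambda(A)$ satisfy $\|v-t\|_\infty>\alpha^{-1}D$. $b$ denotes the binary encoding length of the input $(A,t)$. *)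

(* Defs.v *)
From HB Require Import structures.
From mathcomp Require Import all_boot all_order all_algebra.
From mathcomp Require Import all_classical all_reals all_analysis.

Set Implicit Arguments.
Unset Strict Implicit.
Unset Printing Implicit Defensive.

Import Order.TTheory GRing.Theory Num.Theory.
Local Open Scope ring_scope.

(** * Lattices and the closest vector problem in the maximum norm

    The norm [`| x |] that the library puts on ['cV_n] is the maximum of the
    absolute values of the entries. *)

Definition in_lattice (n : nat) (A : 'M[rat]_n) (v : 'cV[rat]_n) : Prop :=
  exists x : 'cV[int]_n, v = A *m map_mx intr x.

Definition closest_vector (n : nat) (A : 'M[rat]_n) (t w : 'cV[rat]_n) : Prop :=
  in_lattice A w /\ forall u, in_lattice A u -> `|w - t| <= `|u - t|.

Definition approx_closest_vector (R : realType) (eps : R) (n : nat)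
    (A : 'M[rat]_n) (t v : 'cV[rat]_n) : Prop :=
  in_lattice A v /\
  exists2 w, closest_vector A t w &
    ratr `|v - t| <= (1 + eps) * ratr `|w - t|.

(** * Binary encoding length

    The usual convention: 1 + ceil(log2(|p| + 1)) + ceil(log2(q + 1)) for p/q
    in lowest terms, and for a matrix the number of entries plus the sum of
    their lengths. *)

Definition nat_bits (m : nat) : nat := up_log 2 m.+1.

Definition rat_size (q : rat) : nat :=
  (1 + nat_bits `|numq q| + nat_bits `|denq q|)%N.

Definition mx_size (m n : nat) (M : 'M[rat]_(m, n)) : nat :=
  (m * n + \sum_(i < m) \sum_(j < n) rat_size (M i j))%N.

Definition cvp_size (n : nat) (A : 'M[rat]_n) (t : 'cV[rat]_n) : nat :=
  (mx_size A + mx_size t)%N.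

(** * Oracle programs

    Imperative programs with finitely many variables, which hold binary trees
    with integer leaves, under logarithmic cost: arithmetic is charged the bit
    lengths of its operands, an oracle call is charged the size of the query,
    and any other elementary step is charged 1.  A program is a finite text,
    independent of the instance, and it learns about the instance and about
    the oracle's answers only through the operations below; so a bound on the
    number of oracle calls cannot be met by letting an arbitrary function do
    the work between the calls. *)

Inductive data : Type :=
| Num of int
| Cons of data & data.

Fixpoint data_size (d : data) : nat :=
  match d with
  | Num z => (1 + nat_bits `|z|)%N
  | Cons d1 d2 => (1 + data_size d1 + data_size d2)%N
  end.

Definition data_num (d : data) : int := if d is Num z then z else 0.
Definition data_head (d : data) : data := if d is Cons d1 _ then d1 else Num 0.
Definition data_tail (d : data) : data := if d is Cons _ d2 then d2 else Num 0.
Definition data_test (d : data) : bool := if d is Num z then z != 0 else true.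

Inductive binop : Type := OpAdd | OpSub | OpMul | OpDiv | OpLe.

Definition binop_eval (o : binop) (x y : int) : int :=
  match o with
  | OpAdd => x + y
  | OpSub => x - y
  | OpMul => x * y
  | OpDiv => (x %/ y)%Z
  | OpLe => if x <= y then 1 else 0
  end.

Inductive expr : Type :=
| EVar of nat
| ELit of int
| ECons of expr & expr
| EHead of expr
| ETail of expr
| EBin of binop & expr & expr.

Definition store : Type := nat -> data.

Definition store_set (s : store) (x : nat) (d : data) : store :=
  fun y => if y == x then d else s y.

Fixpoint expr_eval (s : store) (e : expr) : data :=
  match e with
  | EVar x => s x
  | ELit z => Num z
  | ECons e1 e2 => Cons (expr_eval s e1) (expr_eval s e2)
  | EHead e1 => data_head (expr_eval s e1)
  | ETail e1 => data_tail (expr_eval s e1)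
  | EBin o e1 e2 =>
      Num (binop_eval o (data_num (expr_eval s e1)) (data_num (expr_eval s e2)))
  end.

Fixpoint expr_cost (s : store) (e : expr) : nat :=
  match e with
  | EVar _ => 1
  | ELit z => (1 + nat_bits `|z|)%N
  | ECons e1 e2 => (1 + expr_cost s e1 + expr_cost s e2)%N
  | EHead e1 => (1 + expr_cost s e1)%N
  | ETail e1 => (1 + expr_cost s e1)%N
  | EBin _ e1 e2 =>
      (1 + nat_bits `|data_num (expr_eval s e1)|
         + nat_bits `|data_num (expr_eval s e2)|
         + expr_cost s e1 + expr_cost s e2)%N
  end.

Inductive cmd : Type :=
| CAssign of nat & expr
| CSeq of cmd & cmd
| CIf of expr & cmd & cmd
| CWhile of expr & cmd
| CCall of nat & expr.

(** [exec O c s s' T k]: with oracle [O], command [c] started in [s] halts in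
    [s'] after time [T] and [k] oracle calls. *)
Inductive exec (O : data -> data) :
    cmd -> store -> store -> nat -> nat -> Prop :=
| exec_assign x e s :
    exec O (CAssign x e) s (store_set s x (expr_eval s e))
      (1 + expr_cost s e)%N 0%N
| exec_seq c1 c2 s s1 s2 T1 T2 k1 k2 :
    exec O c1 s s1 T1 k1 -> exec O c2 s1 s2 T2 k2 ->
    exec O (CSeq c1 c2) s s2 (T1 + T2)%N (k1 + k2)%N
| exec_if e c1 c2 s s1 T k :
    exec O (if data_test (expr_eval s e) then c1 else c2) s s1 T k ->
    exec O (CIf e c1 c2) s s1 (1 + expr_cost s e + T)%N k
| exec_while_stop e c s :
    ~~ data_test (expr_eval s e) ->
    exec O (CWhile e c) s s (1 + expr_cost s e)%N 0%N
| exec_while_step e c s s1 s2 T1 T2 k1 k2 :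
    data_test (expr_eval s e) ->
    exec O c s s1 T1 k1 -> exec O (CWhile e c) s1 s2 T2 k2 ->
    exec O (CWhile e c) s s2 (1 + expr_cost s e + T1 + T2)%N (k1 + k2)%N
| exec_call x e s :
    exec O (CCall x e) s (store_set s x (O (expr_eval s e)))
      (1 + expr_cost s e + data_size (expr_eval s e))%N 1%N.

(** Variable 0 holds the input at the start and the output at the end. *)
Definition computes (O : data -> data) (P : cmd) (input output : data)
    (T k : nat) : Prop :=
  exists2 s', exec O P (store_set (fun=> Num 0) 0%N input) s' T k &
    s' 0%N = output.

(** * Encoding of instances, queries and answers *)

Definition enc_seq (s : seq data) : data := foldr Cons (Num 0) s.

Definition enc_rat (q : rat) : data := Cons (Num (numq q)) (Num (denq q)).

Definition enc_vec (n : nat) (v : 'cV[rat]_n) : data :=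
  enc_seq [seq enc_rat (v i ord0) | i <- enum 'I_n].

Definition enc_mx (n : nat) (A : 'M[rat]_n) : data :=
  enc_seq [seq enc_seq [seq enc_rat (A i j) | j <- enum 'I_n] | i <- enum 'I_n].

Definition enc_instance (n : nat) (A : 'M[rat]_n) (t : 'cV[rat]_n) : data :=
  Cons (enc_mx A) (enc_vec t).

Definition enc_query (n : nat) (A : 'M[rat]_n) (t : 'cV[rat]_n) (D : rat) : data :=
  Cons (enc_instance A t) (enc_rat D).

Definition enc_found (n : nat) (v : 'cV[rat]_n) : data := Cons (Num 1) (enc_vec v).

Definition enc_none : data := Num 0.

(** Nothing is assumed about the answers to inputs that do not encode a
    query. *)
Definition gap_cvp_oracle (R : realType) (alpha : R) (O : data -> data) : Prop :=
  forall (n : nat) (A : 'M[rat]_n) (t : 'cV[rat]_n) (D : rat),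
    (0 < n)%N -> 0 < D ->
    (exists v : 'cV[rat]_n,
       [/\ O (enc_query A t D) = enc_found v, in_lattice A v & `|v - t| <= D])
    \/ (O (enc_query A t D) = enc_none /\
        forall v : 'cV[rat]_n, in_lattice A v ->
          alpha^-1 * ratr D < ratr `|v - t|).

(* Main.v *)
(** Distances from [t] to lattice vectors are multiples of [1 / Q], where [Q] is
    the product of the denominators of the instance, so the query [D = 2^-c]
    with [2^c > Q] either returns [t] itself or shows that the distance is
    positive.  In the second case one asks [D = 2^(a - c)] for
    [a = 1, 2, 4, 8, ...] until a vector is found, and then determines an
    exponent by binary search; as the distance is at most [|t| <= 2^b], this
    takes [O(log b)] calls and leaves a bracket of ratio 2.  Bisecting that
    bracket [O(log 1/eps)] times brings the ratio below [1 + 2 eps / 5], and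
    [(1 + eps / 5) (1 + 2 eps / 5) <= 1 + eps].

    A query must carry [D] in lowest terms.  All the queries have the form
    [m 2^i / 2^j] with [m] odd and [i = 0] or [j = 0], so the program never needs
    to compute a gcd. *)

Require Import Defs.
From HB Require Import structures.
From mathcomp Require Import all_boot all_order all_algebra.
From mathcomp Require Import all_classical all_reals all_analysis.
From mathcomp Require Import zify ring lra.
(* Reimported because ssrnat has a constructor [Num] too. *)
Import Defs.

Set Implicit Arguments.
Unset Strict Implicit.
Unset Printing Implicit Defensive.

Import Order.TTheory GRing.Theory Num.Theory.
Local Open Scope ring_scope.

(** * Bit lengths and powers of two *)

Lemma nat_bits_exp a : nat_bits (2 ^ a) = a.+1.
Proof.
apply: up_log_eq => //; rewrite ltnS leqnn /=.
by rewrite expnS mul2n -addnn -addn1 leq_add2l expn_gt0.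
Qed.

Lemma nat_bits_le m B : (m < 2 ^ B)%N -> (nat_bits m <= B)%N.
Proof. exact: up_log_min. Qed.

Lemma ltn_nat_bits m : (m < 2 ^ nat_bits m)%N.
Proof. exact: up_logP. Qed.

Lemma nat_bits_leX m B : (m <= 2 ^ B)%N -> (nat_bits m <= B.+1)%N.
Proof.
move=> mB; apply: nat_bits_le; apply: leq_ltn_trans mB _.
by rewrite ltn_exp2l.
Qed.

Lemma nat_bits0 : nat_bits 0 = 0%N. Proof. exact: up_log1. Qed.
Lemma nat_bits1 : nat_bits 1 = 1%N. Proof. exact: (nat_bits_exp 0). Qed.

(** * Running programs on stores given by lists *)

(** A list stands for a store with finitely many nonzero variables: the default [Num 0] is what
    every variable but the input holds at the start in [computes]. *)
Definition st (l : seq data) : store := nth (Num 0) l.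
Arguments st l /.

Lemma store_set_st l x d : store_set (st l) x d = st (set_nth (Num 0) l x d).
Proof. by apply/funext=> y; rewrite /st nth_set_nth. Qed.

(* [T] and [k] are upper bounds, not the exact cost. *)
Definition runs (O : data -> data) (c : cmd) (l : seq data)
    (Post : seq data -> Prop) (T k : nat) : Prop :=
  exists l' T' k', [/\ exec O c (st l) (st l') T' k', Post l',
    (T' <= T)%N & (k' <= k)%N].

Lemma runs_weaken O c l (Q : seq data -> Prop) T k (Q' : seq data -> Prop) T' k' :
  runs O c l Q T k -> (forall l', Q l' -> Q' l') ->
  (T <= T')%N -> (k <= k')%N -> runs O c l Q' T' k'.
Proof.
move=> [l1 [T1 [k1 [ex q1 t1 kk1]]]] qq tt kk.
by exists l1, T1, k1; split=> //; [exact: qq|exact: leq_trans tt|exact: leq_trans kk].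
Qed.

Lemma runs_le O c l (Q : seq data -> Prop) T k T' k' :
  runs O c l Q T k -> (T <= T')%N -> (k <= k')%N -> runs O c l Q T' k'.
Proof. by move=> r; apply: runs_weaken r _. Qed.

Lemma runs_assign O x e l (Q : seq data -> Prop) :
  Q (set_nth (Num 0) l x (expr_eval (st l) e)) ->
  runs O (CAssign x e) l Q (1 + expr_cost (st l) e) 0.
Proof.
move=> q; eexists _, _, _; split; [|exact: q|exact: leqnn|exact: leqnn].
by rewrite -store_set_st; exact: exec_assign.
Qed.

Lemma runs_call O x e l (Q : seq data -> Prop) :
  Q (set_nth (Num 0) l x (O (expr_eval (st l) e))) ->
  runs O (CCall x e) l Q
    (1 + expr_cost (st l) e + data_size (expr_eval (st l) e)) 1.
Proof.
move=> q; eexists _, _, _; split; [|exact: q|exact: leqnn|exact: leqnn].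
by rewrite -store_set_st; exact: exec_call.
Qed.

(** The run of [c2] is the postcondition of [c1], so a program is executed symbolically from left to
    right and the costs are collected on the way. *)
Lemma runs_seq O c1 c2 l (Q : seq data -> Prop) T1 T2 k1 k2 :
  runs O c1 l (fun l1 => runs O c2 l1 Q T2 k2) T1 k1 ->
  runs O (CSeq c1 c2) l Q (T1 + T2) (k1 + k2).
Proof.
move=> [l1 [t1 [j1 [e1 [l2 [t2 [j2 [e2 q h2 g2]]]] h1 g1]]]].
exists l2, (t1 + t2)%N, (j1 + j2)%N; split=> //; try exact: leq_add.
exact: exec_seq e1 e2.
Qed.

Lemma runs_if O e c1 c2 l (Q : seq data -> Prop) T k :
  runs O (if data_test (expr_eval (st l) e) then c1 else c2) l Q T k ->
  runs O (CIf e c1 c2) l Q (1 + expr_cost (st l) e + T) k.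
Proof.
move=> [l1 [t1 [j1 [e1 q h1 g1]]]].
exists l1, (1 + expr_cost (st l) e + t1)%N, j1; split=> //; last by rewrite leq_add2l.
exact: exec_if.
Qed.

Lemma runs_while_stop O e c l (Q : seq data -> Prop) :
  data_test (expr_eval (st l) e) = false -> Q l ->
  runs O (CWhile e c) l Q (1 + expr_cost (st l) e) 0.
Proof.
move=> h q; exists l, (1 + expr_cost (st l) e)%N, 0%N; split=> //.
by apply: exec_while_stop; rewrite h.
Qed.

(** The unrolled loop is phrased as a [CSeq] so that [runs_seq] continues the symbolic run; loops
    are then treated by induction. *)
Lemma runs_while_step O e c l (Q : seq data -> Prop) T k :
  data_test (expr_eval (st l) e) = true ->
  runs O (CSeq c (CWhile e c)) l Q T k ->
  runs O (CWhile e c) l Q (1 + expr_cost (st l) e + T) k.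
Proof.
move=> h [l1 [t1 [j1 [ex q h1 g1]]]].
inversion ex; subst.
exists l1, (1 + expr_cost (st l) e + T1 + T2)%N, (k1 + k2)%N.
split=> //; last by rewrite -addnA leq_add2l.
by apply: exec_while_step => //; eassumption.
Qed.

Lemma binop_add a b : binop_eval OpAdd (Posz a) (Posz b) = Posz (a + b).
Proof. by []. Qed.
Lemma binop_mul a b : binop_eval OpMul (Posz a) (Posz b) = Posz (a * b).
Proof. by rewrite /= PoszM. Qed.
Lemma binop_div a b : binop_eval OpDiv (Posz a) (Posz b) = Posz (a %/ b).
Proof. exact: divz_nat. Qed.
Lemma binop_le a b : binop_eval OpLe (Posz a) (Posz b) = Posz (a <= b)%N.
Proof. by rewrite /= lez_nat; case: leqP. Qed.
Lemma binop_pred a : binop_eval OpSub (Posz a.+1) (Posz 1) = Posz a.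
Proof. by rewrite /= -addn1 PoszD addrK. Qed.
Definition binopE := (binop_add, binop_mul, binop_div, binop_le, binop_pred).
Arguments binop_eval : simpl never.

(** * The program *)

(* The denominator phase and the search share the variables 1, 2 and 3. *)
Local Notation xInst := 0%N.
Local Notation xRows := 1%N.
Local Notation xStack := 1%N.
Local Notation xQ := 2%N.
Local Notation xLo := 2%N.
Local Notation xRow := 3%N.
Local Notation xP := 3%N.
Local Notation xq := 4%N.
Local Notation xAns := 5%N.
Local Notation xNum := 6%N.
Local Notation xDen := 7%N.
Local Notation xBest := 8%N.
Local Notation xM := 9%N.

(** * Product of all denominators *)

Definition den_row : cmd :=
  CWhile (EVar xRow)
    (CSeq (CAssign xQ (EBin OpMul (EVar xQ) (ETail (EHead (EVar xRow)))))
          (CAssign xRow (ETail (EVar xRow)))).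

Definition den_rows : cmd :=
  CWhile (EVar xRows)
    (CSeq (CAssign xRow (EHead (EVar xRows)))
    (CSeq (CAssign xRows (ETail (EVar xRows))) den_row)).

Definition dens (r : seq rat) : nat := \prod_(x <- r) `|denq x|%N.
Definition dens2 (rs : seq (seq rat)) : nat := \prod_(r <- rs) dens r.

Lemma dens_gt0 r : (0 < dens r)%N.
Proof. by rewrite /dens prodn_gt0 // => x; rewrite absz_gt0 denq_neq0. Qed.

Lemma dens2_gt0 rs : (0 < dens2 rs)%N.
Proof. by rewrite /dens2 prodn_gt0 // => x; exact: dens_gt0. Qed.

(** Denominators are positive, so every partial product stays below the final one and has at most
    [B + 1] bits. The list itself is the loop test: [Cons] tests true and the empty list [Num 0]
    false. *)
Lemma den_row_runs O B r a inst rows rest :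
  (0 < a)%N -> (a * dens r <= 2 ^ B)%N ->
  runs O den_row [:: inst, rows, Num (Posz a), enc_seq (map enc_rat r) & rest]
    (eq [:: inst, rows, Num (Posz (a * dens r)), Num 0 & rest])
    (size r * (2 * B + 20) + 2) 0.
Proof.
elim: r a => [|x r IH] a a0 aB.
  apply: runs_le; first by apply: runs_while_stop => //; rewrite /dens big_nil muln1.
    by rewrite /=.
  by [].
have d0 : (0 < `|denq x|)%N by rewrite absz_gt0 denq_neq0.
have E : (a * dens (x :: r) = a * `|denq x| * dens r)%N by rewrite /dens big_cons mulnA.
have r0 := dens_gt0 r.
rewrite E in aB *.
have ad0 : (0 < a * `|denq x|)%N by rewrite muln_gt0 a0.
have adB : (a * `|denq x| <= 2 ^ B)%N by apply: leq_trans aB; rewrite leq_pmulr.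
have h1 : (nat_bits a <= B.+1)%N.
  by apply: nat_bits_leX; apply: leq_trans adB; rewrite leq_pmulr.
have h2 : (nat_bits `|denq x| <= B.+1)%N.
  by apply: nat_bits_leX; apply: leq_trans adB; rewrite leq_pmull.
apply: runs_le.
  apply: runs_while_step => //; apply: runs_seq; apply: runs_seq.
  apply: runs_assign => /=; apply: runs_assign => /=.
  by rewrite -absz_denq binopE; apply: IH.
all: rewrite /=; lia.
Qed.

Lemma den_rows_runs O B rs a inst row rest :
  (0 < a)%N -> (a * dens2 rs <= 2 ^ B)%N ->
  runs O den_rows
    [:: inst, enc_seq [seq enc_seq (map enc_rat r) | r <- rs], Num (Posz a), row & rest]
    (fun l => exists row', l = [:: inst, Num 0, Num (Posz (a * dens2 rs)), row' & rest])
    ((\sum_(r <- rs) (size r + 1)) * (2 * B + 30) + 2) 0.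
Proof.
elim: rs a row => [|r rs IH] a row a0 aB.
  apply: runs_le; first apply: runs_while_stop => //.
  - by exists row; rewrite /dens2 big_nil muln1.
  - by rewrite big_nil /=; lia.
  - by [].
have E : (a * dens2 (r :: rs) = a * dens r * dens2 rs)%N by rewrite /dens2 big_cons mulnA.
have r0 := dens_gt0 r; have rs0 := dens2_gt0 rs.
rewrite E big_cons in aB *.
have ad0 : (0 < a * dens r)%N by rewrite muln_gt0 a0.
have adB : (a * dens r <= 2 ^ B)%N by apply: leq_trans aB; rewrite leq_pmulr.
apply: runs_le.
  apply: runs_while_step => //; apply: runs_seq; apply: runs_seq.
  apply: runs_assign => /=; apply: runs_seq; apply: runs_assign => /=.
  apply: runs_weaken; first exact: (den_row_runs O _ _ _ a0 adB).
  - by move=> l <-; apply: IH.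
  - exact: leqnn.
  - exact: leqnn.
1,2: rewrite /=; nia.
Qed.

(** * A power of two above the product *)

Definition pow_loop : cmd :=
  CWhile (EBin OpLe (EVar xq) (EVar xQ))
    (CAssign xq (EBin OpAdd (EVar xq) (EVar xq))).

(** [f] is fuel: [2 ^ (c + f)] already exceeds [Q], so at most [f] doublings remain. *)
Lemma pow_loop_runs O B Q f c inst rows row rest :
  (Q <= 2 ^ B)%N -> (Q < 2 ^ (c + f))%N -> (c + f <= B.+1)%N ->
  runs O pow_loop [:: inst, rows, Num (Posz Q), row, Num (Posz (2 ^ c)%N) & rest]
    (fun l => exists c',
      [/\ l = [:: inst, rows, Num (Posz Q), row, Num (Posz (2 ^ c')%N) & rest],
       (Q < 2 ^ c')%N & (c' <= c + f)%N])
    (f * (4 * B + 30) + (2 * B + 20)) 0.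
Proof.
move=> QB; have hQ := nat_bits_leX QB.
elim: f c => [|f IH] c Qc cB; case: (leqP (2 ^ c)%N Q) => h.
- by move: Qc; rewrite addn0 ltnNge h.
- apply: runs_le.
    apply: runs_while_stop; first by rewrite /= binopE leqNgt h.
    by exists c; rewrite h addn0.
  1,2: rewrite /= ?nat_bits_exp; lia.
- apply: runs_le.
    apply: runs_while_step; first by rewrite /= binopE h.
    apply: runs_seq; apply: runs_assign => /=.
    rewrite binopE addnn -mul2n -expnS.
    apply: runs_weaken; first (by apply: IH; rewrite addSnnS);
      [|exact: leqnn|exact: leqnn].
    by move=> l [c' [-> ? ?]]; exists c'; split=> //; rewrite -addSnnS.
  1,2: rewrite /= ?nat_bits_exp; lia.
- apply: runs_le.
    apply: runs_while_stop; first by rewrite /= binopE leqNgt h.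
    by exists c; rewrite h leq_addr.
  1,2: rewrite /= ?nat_bits_exp; lia.
Qed.

(** * Quotients of powers of two in lowest terms *)

Definition normalize (e : nat) : cmd :=
  CIf (EBin OpLe (EVar e) (EVar xq))
    (CSeq (CAssign xNum (ELit (Posz 1)))
          (CAssign xDen (EBin OpDiv (EVar xq) (EVar e))))
    (CSeq (CAssign xNum (EBin OpDiv (EVar e) (EVar xq)))
          (CAssign xDen (ELit (Posz 1)))).

(** The smaller power divides the larger, so the division is exact. Truncated subtraction describes
    both branches at once, since one of the two exponents is 0. *)
Lemma normalize_runs O e d0 d1 d2 d3 d5 d6 d7 d8 d9 a c (Post : seq data -> Prop) :
  e \in [:: xLo; xP] ->
  nth (Num 0) [:: d0; d1; d2; d3] e = Num (Posz (2 ^ a)%N) ->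
  Post [:: d0; d1; d2; d3; Num (Posz (2 ^ c)%N); d5;
           Num (Posz (2 ^ (a - c))%N); Num (Posz (2 ^ (c - a))%N); d8; d9] ->
  runs O (normalize e) [:: d0; d1; d2; d3; Num (Posz (2 ^ c)%N); d5; d6; d7; d8; d9]
    Post (2 * (a + c) + 20) 0.
Proof.
rewrite !inE => /orP[] /eqP-> /= -> post.
all: have [ac|ca] := leqP a c;
  [have z : (a - c = 0)%N by lia|have z : (c - a = 0)%N by lia].
all: rewrite z in post; apply: runs_le;
  [apply: runs_if; rewrite /= binopE leq_exp2l // ?ac ?(leqNgt a c) ?ca /=;
   apply: runs_seq; apply: runs_assign => /=; apply: runs_assign => /=;
   rewrite binopE -expnB // ltnW //
  |rewrite /= !nat_bits_exp nat_bits1; lia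
  |by []].
Qed.

Definition dyadic (m i j : nat) : rat := (m * 2 ^ i)%:R / (2 ^ j)%:R.

(** This rule and the next are the two ways to halve the unit [2 ^ i / 2 ^ j] while doubling the
    multiplier. *)
Lemma dyadicSl m i j : dyadic m i.+1 j = dyadic (2 * m) i j.
Proof. by rewrite /dyadic expnS mulnA (mulnC m). Qed.

Lemma dyadicSr m i j : dyadic (2 * m) i j.+1 = dyadic m i j.
Proof.
rewrite /dyadic expnS -mulnA !natrM -mulf_div divff ?mul1r ?natrM //.
Qed.

Lemma dyadicDD m i j k : dyadic m (i + k) (j + k) = dyadic m i j.
Proof.
rewrite /dyadic !expnD mulnA natrM [((2 ^ j) * _)%:R]natrM -mulf_div divff ?mulr1 //.
Qed.

Lemma dyadic_norm m a c : dyadic m (a - c) (c - a) = dyadic m a c.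
Proof.
have [ac|ca] := leqP a c.
  by rewrite -(dyadicDD _ _ _ a) subnK // (eqP (_ : (a - c)%N == 0%N)).
rewrite -(dyadicDD _ _ _ c) subnK ?(ltnW ca) //.
by rewrite (eqP (_ : (c - a)%N == 0%N)) // subn_eq0 ltnW.
Qed.

(** * The search procedures *)

Definition ask (en ed : expr) : cmd :=
  CCall xAns (ECons (EVar xInst) (ECons en ed)).

Definition ask_power (e : nat) : cmd :=
  CSeq (normalize e) (ask (EVar xNum) (EVar xDen)).

(** [enc_none] has head 0 and a found vector has head 1, so the loop goes on exactly while nothing
    is found. Every refused power [2 ^ (2 ^ j)] is pushed, so that the binary search can pop its
    step widths instead of taking roots. *)
Definition square_loop : cmd :=
  CWhile (EBin OpLe (EHead (EVar xAns)) (ELit (Posz 0)))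
    (CSeq (CAssign xStack (ECons (EVar xP) (EVar xStack)))
    (CSeq (CAssign xP (EBin OpMul (EVar xP) (EVar xP))) (ask_power xP))).

Definition exponent_loop : cmd :=
  CWhile (EVar xStack)
    (CSeq (CAssign xP (EBin OpMul (EVar xLo) (EHead (EVar xStack))))
    (CSeq (CAssign xStack (ETail (EVar xStack)))
    (CSeq (ask_power xP)
      (CIf (EVar xAns) (CAssign xBest (EVar xAns)) (CAssign xLo (EVar xP)))))).

(** With [u] the fraction in [xNum] and [xDen] and [m] the value of [xM], the bracket runs from
    [m * u] to [(m + 1) * u]. Halving [u] makes the midpoint the odd multiple [2 * m + 1]. The last
    assignment only fills the second branch of [CIf]. *)
Definition bisect_loop (M : nat) : cmd :=
  CWhile (EBin OpLe (EVar xM) (ELit (Posz M)))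
    (CSeq (CIf (EBin OpLe (EVar xNum) (ELit (Posz 1)))
             (CAssign xDen (EBin OpAdd (EVar xDen) (EVar xDen)))
             (CAssign xNum (EBin OpDiv (EVar xNum) (ELit (Posz 2)))))
    (CSeq (CAssign xM (EBin OpAdd (EBin OpAdd (EVar xM) (EVar xM)) (ELit (Posz 1))))
    (CSeq (ask (EBin OpMul (EVar xM) (EVar xNum)) (EVar xDen))
      (CIf (EVar xAns)
         (CSeq (CAssign xBest (EVar xAns))
               (CAssign xM (EBin OpSub (EVar xM) (ELit (Posz 1)))))
         (CAssign xBest (EVar xBest)))))).

Definition search (M : nat) : cmd :=
  CSeq (CAssign xP (ELit (Posz 2)))
  (CSeq (ask_power xP)
  (CSeq square_loop
  (CSeq (CAssign xBest (EVar xAns))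
  (CSeq (CAssign xLo (ELit (Posz 1)))
  (CSeq exponent_loop
  (CSeq (normalize xLo)
  (CSeq (CAssign xM (ELit (Posz 1)))
        (bisect_loop M)))))))).

(* The stack that [square_loop] leaves for [exponent_loop]. *)
Fixpoint tower (j : nat) : data :=
  if j is j'.+1 then Cons (Num (Posz (2 ^ (2 ^ j'))%N)) (tower j') else Num 0.

(** * Analysis of the search against an abstract gap oracle *)

Section Search.

Variables (O : data -> data) (inst : data) (c H : nat).
Variables (yes : data -> rat -> Prop) (no : rat -> Prop).

(** At a minimal distance [d], both answers are legal for [d <= D < alpha * d]. The search therefore
    relies on no monotonicity and carries just one refused value below and one accepted value
    above. *)
Definition answers (a : data) (D : rat) : Prop := yes a D \/ a = Num 0 /\ no D.

Hypothesis yes_cons : forall a D, yes a D -> exists d, a = Cons (Num (Posz 1)) d.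
Hypothesis oracle_dyadic : forall m i j, odd m -> (i == 0%N) || (j == 0%N) ->
  answers (O (Cons inst (Cons (Num (Posz (m * 2 ^ i)%N)) (Num (Posz (2 ^ j)%N)))))
    (dyadic m i j).
Hypothesis no_lt : forall a, no (dyadic 1 a c) -> (a < H)%N.

(** Time of one pass of the two exponent searches: by [no_lt] the exponents tried are at most
    [2 * H], so the numbers have [O(H + c)] bits. *)
Let W := (data_size inst + 20 * (H + c) + 100)%N.

Lemma ask_power_runs e d0 d1 d2 d5 d6 d7 d8 d9 a (Post : seq data -> Prop) :
  e \in [:: xLo; xP] ->
  nth (Num 0) [:: inst; d0; d1; d2] e = Num (Posz (2 ^ a)%N) ->
  (forall ans, answers ans (dyadic 1 a c) ->
    Post [:: inst; d0; d1; d2; Num (Posz (2 ^ c)%N); ans;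
           Num (Posz (2 ^ (a - c))%N); Num (Posz (2 ^ (c - a))%N); d8; d9]) ->
  runs O (ask_power e) [:: inst; d0; d1; d2; Num (Posz (2 ^ c)%N); d5; d6; d7; d8; d9]
    Post (data_size inst + 3 * (a + c) + 40) 1.
Proof.
move=> he ha post; apply: runs_le.
  apply: runs_seq; apply: normalize_runs he ha _; apply: runs_call => /=.
  apply: post; rewrite -dyadic_norm -{1}[(2 ^ (a - c))%N]mul1n.
  apply: oracle_dyadic => //; rewrite !subn_eq0; exact: leq_total.
all: rewrite /= ?nat_bits_exp; lia.
Qed.

(** [f] counts the squarings left. A refusal at [2 ^ j] gives [2 ^ j < H], which keeps the next
    exponent within [2 * H]. *)
Lemma square_loop_runs f j ans d2 d6 d7 d8 d9 :
  (j + f)%N = up_log 2 H -> (2 ^ j <= 2 * H)%N ->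
  answers ans (dyadic 1 (2 ^ j) c) ->
  runs O square_loop
    [:: inst; tower j; d2; Num (Posz (2 ^ (2 ^ j))%N); Num (Posz (2 ^ c)%N);
        ans; d6; d7; d8; d9]
    (fun l => exists j' ans' d3' d6' d7',
      [/\ l = [:: inst; tower j'; d2; d3'; Num (Posz (2 ^ c)%N); ans'; d6'; d7'; d8; d9],
          yes ans' (dyadic 1 (2 ^ j') c), (2 ^ j' <= 2 * H)%N & (j' <= up_log 2 H)%N])
    (f * W + 10) f.
Proof.
elim: f j ans d6 d7 => [|f IH] j ans d6 d7 jf jH [ya|[-> na]].
1,3: have [d da] := yes_cons ya.
1,2: apply: runs_le;
  [ apply: runs_while_stop; [by rewrite /= da /= ?binopE
    | by exists j, ans; do 3 eexists; split; [reflexivity|by []|by []|lia] ]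
  | rewrite /= da /= nat_bits1 nat_bits0; lia
  | by []].
  (* The fuel is spent, so [j = up_log 2 H] and [H <= 2 ^ j], against [no_lt]. *)
  have := no_lt na; have := up_logP H (isT : (1 < 2)%N); rewrite -jf addn0; lia.
have jH' := no_lt na.
apply: runs_le.
  apply: runs_while_step; first by [].
  apply: runs_seq; apply: runs_seq; apply: runs_assign => /=.
  apply: runs_seq; apply: runs_assign => /=.
  rewrite binopE -expnD addnn -mul2n -expnS.
  apply: ask_power_runs => // ans' ha'.
  apply: (IH j.+1) => //; first by lia.
  rewrite expnS; lia.
all: rewrite /= ?nat_bits_exp ?nat_bits0 ?expnS /W; lia.
Qed.

(** The bracket of exponents has width [2 ^ j], and each entry popped halves it. The empty stack
    leaves width 1, that is, two queries of ratio 2. *)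
Lemma exponent_loop_runs j e best d3 d5 d6 d7 d9 :
  no (dyadic 1 e c) -> yes best (dyadic 1 (e + 2 ^ j) c) -> (2 ^ j <= 2 * H)%N ->
  runs O exponent_loop
    [:: inst; tower j; Num (Posz (2 ^ e)%N); d3; Num (Posz (2 ^ c)%N); d5; d6; d7; best; d9]
    (fun l => exists e' best' d3' d5' d6' d7',
      [/\ l = [:: inst; Num 0; Num (Posz (2 ^ e')%N); d3'; Num (Posz (2 ^ c)%N);
                  d5'; d6'; d7'; best'; d9],
          no (dyadic 1 e' c) & yes best' (dyadic 1 e'.+1 c)])
    (j * W + 2) j.
Proof.
elim: j e best d3 d5 d6 d7 => [|j IH] e best d3 d5 d6 d7 ne ye jH.
  apply: runs_le;
    [apply: runs_while_stop => //; exists e, best; do 4 eexists; split;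
      [reflexivity|by []|by move: ye; rewrite expn0 addn1]|by []|by []].
have eH := no_lt ne.
rewrite expnS in ye jH.
apply: runs_le.
  apply: runs_while_step => //=.
  apply: runs_seq; apply: runs_seq; apply: runs_assign => /=.
  apply: runs_seq; apply: runs_assign => /=.
  rewrite binopE -expnD; apply: (@runs_seq _ _ _ _ _ _ 10 _ 0).
  apply: ask_power_runs => // ans [ya|[-> na]].
    have [d da] := yes_cons ya.
    apply: (@runs_le _ _ _ _ 4 0) => //; rewrite da.
    apply: runs_if => /=; apply: runs_assign => /=; rewrite -da.
    by apply: IH => //; lia.
  apply: (@runs_le _ _ _ _ 4 0) => //.
  apply: runs_if => /=; apply: runs_assign => /=.
  (* After a refusal the upper end stays: [e + 2 ^ j.+1 = (e + 2 ^ j) + 2 ^ j]. *)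
  by apply: IH => //; [rewrite -addnA addnn -mul2n|lia].
all: rewrite /= ?nat_bits_exp /W; lia.
Qed.

(* The lower end [m] lies in [[2^s, 2^(s+1))] and [s] grows by one per step. *)
Lemma bisect_loop_runs M K f s m i j best d1 d2 d3 d4 d5 :
  (M < 2 ^ K)%N -> (s + f)%N = K -> (2 ^ s <= m < 2 ^ s.+1)%N ->
  (i == 0%N) || (j == 0%N) -> (i <= H)%N -> (j + f <= c + K)%N ->
  no (dyadic m i j) -> yes best (dyadic m.+1 i j) ->
  runs O (bisect_loop M)
    [:: inst; d1; d2; d3; d4; d5; Num (Posz (2 ^ i)%N); Num (Posz (2 ^ j)%N); best;
        Num (Posz m)]
    (fun l => exists m' i' j' best', [/\ nth (Num 0) l xBest = best', (M < m')%N,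
       no (dyadic m' i' j') & yes best' (dyadic m'.+1 i' j')])
    (f * (data_size inst + 20 * (H + c + K) + 100) + (3 * K + 10)) f.
Proof.
move=> MK; have bM := nat_bits_le MK.
elim: f s m i j best d5 => [|f IH] s m i j best d5 sf /andP[sm ms] ij iH jc nm ym;
  have bm := nat_bits_le ms; case: (leqP m M) => hm.
(* Without fuel [s = K], so [m >= 2 ^ K > M] and the loop cannot still be running. *)
- by have := leq_ltn_trans (leq_trans sm hm) MK; rewrite -sf addn0 ltnn.
1,3: apply: runs_le;
  [apply: runs_while_stop; [by rewrite /= binopE leqNgt hm|by exists m, i, j, best]
  |rewrite /=; lia|by []].
have m1 : (0 < m)%N by apply: leq_trans sm; rewrite expn_gt0.
(* The halved unit: lower the numerator exponent while it is positive, otherwise raise that of the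
   denominator. One of the two stays 0. *)
pose i' := i.-1; pose j' := (if i == 0 then j.+1 else j)%N.
have ij' : (i' == 0%N) || (j' == 0%N).
  by rewrite /i' /j'; case: (i) ij => //= k; rewrite orbC => ->.
have dm p : dyadic p i j = dyadic (2 * p) i' j'.
  rewrite /i' /j'; case: (i) => [|k] /=; last exact: dyadicSl.
  by rewrite dyadicSr.
have odd1 : odd (2 * m).+1 by rewrite /= oddM.
have bm' : (nat_bits (2 * m).+1 <= s.+2)%N.
  by apply: nat_bits_le; move: ms; rewrite !expnS; lia.
have bm2 : (nat_bits (2 * m) <= s.+2)%N.
  by apply: nat_bits_le; move: ms; rewrite !expnS; lia.
have bmx : (nat_bits ((2 * m).+1 * 2 ^ i') <= s.+2 + i')%N.
  by apply: nat_bits_le; rewrite expnD ltn_mul2r expn_gt0 /=; move: ms; rewrite !expnS; lia.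
have jf : (j' + f <= c + K)%N by rewrite /j'; case: ifP; lia.
have iH' : (i' <= H)%N by rewrite /i'; lia.
(* In the new unit the bracket is [2 * m] to [2 * m + 2]; the answer at [2 * m + 1] selects a
   half. *)
rewrite !dm in nm ym.
apply: runs_le.
  apply: runs_while_step; first by rewrite /= binopE hm.
  apply: runs_seq.
  apply: (@runs_seq _ _ _ _ _ _ (data_size inst + 10 * (H + c + K) + 60) _ 1).
  have halve (Post : seq data -> Prop) :
      Post [:: inst; d1; d2; d3; d4; d5; Num (Posz (2 ^ i')%N); Num (Posz (2 ^ j')%N); best;
             Num (Posz m)] ->
      runs O (CIf (EBin OpLe (EVar xNum) (ELit (Posz 1)))
             (CAssign xDen (EBin OpAdd (EVar xDen) (EVar xDen)))
             (CAssign xNum (EBin OpDiv (EVar xNum) (ELit (Posz 2)))))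
        [:: inst; d1; d2; d3; d4; d5; Num (Posz (2 ^ i)%N); Num (Posz (2 ^ j)%N); best;
            Num (Posz m)]
        Post (3 * (i + j) + 20) 0.
    rewrite /i' /j'; case: (i) => [|k] /= post; apply: runs_le.
    + apply: runs_if; rewrite /= ?binopE /=; apply: runs_assign => /=.
      by rewrite binopE addnn -mul2n -expnS.
    + rewrite /= ?nat_bits_exp ?nat_bits1; lia.
    + by [].
    + apply: runs_if; rewrite /= binopE leqNgt -[1%N](expn0 2) ltn_exp2l //=.
      apply: runs_assign => /=.
      by rewrite binopE expnS mulKn.
    + rewrite /= ?nat_bits_exp nat_bits1 (nat_bits_exp 1); lia.
    + by [].
  apply: halve; apply: (@runs_le _ _ _ _ (data_size inst + 9 * (H + c + K) + 60) 1);
    [|lia|by []].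
  apply: runs_le.
    apply: runs_seq; apply: runs_assign => /=.
    rewrite !binopE addnn -mul2n addn1.
    apply: (@runs_seq _ _ _ _ _ _ (20 + 2 * s) _ 0).
    apply: runs_call => /=; rewrite binopE.
    case: (oracle_dyadic odd1 ij') => [ya|[-> na]].
      have [d da] := yes_cons ya; rewrite {1}da.
      apply: runs_le.
        apply: runs_if => /=; apply: runs_seq; apply: runs_assign => /=.
        apply: runs_assign => /=; rewrite binopE -da.
        apply: (IH s.+1) => //; first lia.
        by apply/andP; split; move: sm ms; rewrite !expnS; lia.
      1,2: rewrite /= ?nat_bits1; lia.
    apply: runs_le.
      apply: runs_if => /=; apply: runs_assign => /=.
      apply: (IH s.+1) => //; first lia.
      by apply/andP; split; move: sm ms; rewrite !expnS; lia.
      by move: ym; rewrite mulnS.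
    1,2: rewrite /= ?nat_bits1; lia.
  1,2: rewrite /= ?binopE ?addnn -?mul2n ?nat_bits_exp ?nat_bits1; lia.
all: rewrite /=; lia.
Qed.

(** One opening call, at most [J] calls for squaring and [J] for the binary search, and at most one
    per bit of [M] for bisection. The given refusal at exponent 0 is the first lower end of the
    binary search. *)
Lemma search_runs M d2 d3 d5 d6 d7 d8 d9 :
  no (dyadic 1 0 c) ->
  let J := up_log 2 H in let K := nat_bits M in
  runs O (search M) [:: inst; Num 0; d2; d3; Num (Posz (2 ^ c)%N); d5; d6; d7; d8; d9]
    (fun l => exists m i j best, [/\ nth (Num 0) l xBest = best, (M < m)%N,
       no (dyadic m i j) & yes best (dyadic m.+1 i j)])
    ((2 * J + K + 4) * (data_size inst + 20 * (H + c + K) + 100)) (2 * J + K + 1).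
Proof.
move=> n0 J K; have H0 := no_lt n0.
apply: runs_le.
  apply: runs_seq; apply: runs_assign => /=; apply: runs_seq.
  apply: (@ask_power_runs _ _ _ _ _ _ _ _ _ 1) => // ans ha.
  apply: (@runs_seq _ _ _ _ _ _ (J * W + 2 * (H + c) + 60 +
    (K * (data_size inst + 20 * (H + c + K) + 100) + (3 * K + 10))) _ (J + K)).
  apply: runs_weaken.
  - by apply: (@square_loop_runs J 0 ans) => //; rewrite expn0; lia.
  - move=> _ [j [best [d3' [d6' [d7' [-> yb jH jJ]]]]]].
    apply: runs_le.
      apply: runs_seq; apply: runs_assign => /=.
      apply: runs_seq; apply: runs_assign => /=.
      apply: (@runs_seq _ _ _ _ _ _ (2 * (H + c) + 40 +
        (K * (data_size inst + 20 * (H + c + K) + 100) + (3 * K + 10))) _ K).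
      apply: runs_weaken.
      + exact: (@exponent_loop_runs j 0 best).
      + move=> _ [e [best' [d3'' [d5'' [d6'' [d7'' [-> ne ye]]]]]]].
        have eH := no_lt ne.
        apply: runs_le.
          apply: runs_seq.
          apply: (@normalize_runs _ _ _ _ _ _ _ _ _ _ _ e) => //.
          apply: runs_seq; apply: runs_assign => /=.
          apply: (@bisect_loop_runs M K K 0).
          * exact: ltn_nat_bits.
          * by [].
          * by [].
          * by rewrite !subn_eq0 leq_total.
          * by lia.
          * by lia.
          * by rewrite dyadic_norm.
          (* Exponents [e] and [e + 1] form the bracket with [m = 1] in the unit [2 ^ e / 2 ^ c]. *)
          * by rewrite dyadic_norm -[2%N]muln1 -dyadicSl.
        1,2: rewrite /= ?nat_bits1; lia.
      + exact: leqnn.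
      + exact: leqnn.
    1,2: rewrite /= ?nat_bits1 /W; nia.
  - exact: leqnn.
  - exact: leqnn.
all: rewrite /= ?(nat_bits_exp 1) /W; nia.
Qed.

End Search.

(** * The whole program *)

Definition cvp_program (M : nat) : cmd :=
  CSeq (CAssign xRows (ECons (ETail (EVar xInst)) (EHead (EVar xInst))))
  (CSeq (CAssign xQ (ELit (Posz 1)))
  (CSeq den_rows
  (CSeq (CAssign xq (ELit (Posz 1)))
  (CSeq pow_loop
  (CSeq (ask (ELit (Posz 1)) (EVar xq))
  (CSeq (CIf (EVar xAns) (CAssign xBest (EVar xAns)) (search M))
        (CAssign xInst (ETail (EVar xBest))))))))).

(** As [Q <= 2 ^ B], the power found has exponent at most [B + 1], and for such [c] the refused
    exponents are bounded by [H]. The two outcomes are a hit on the first query and a bracket left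
    by the search. *)
Lemma cvp_program_runs (O : data -> data) (yes : data -> rat -> Prop)
    (no : rat -> Prop) (M B H : nat) (trow : seq rat) (rows : seq (seq rat)) :
  let inst := Cons (enc_seq [seq enc_seq (map enc_rat r) | r <- rows])
                   (enc_seq (map enc_rat trow)) in
  let Q := dens2 (trow :: rows) in
  let J := up_log 2 H in let K := nat_bits M in
  (forall a D, yes a D -> exists d, a = Cons (Num (Posz 1)) d) ->
  (forall m i j, odd m -> (i == 0%N) || (j == 0%N) ->
    answers yes no
      (O (Cons inst (Cons (Num (Posz (m * 2 ^ i)%N)) (Num (Posz (2 ^ j)%N)))))
      (dyadic m i j)) ->
  (forall c a, (c <= B.+1)%N -> no (dyadic 1 a c) -> (a < H)%N) ->
  (Q <= 2 ^ B)%N ->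
  runs O (cvp_program M) (inst :: nseq 9 (Num 0))
    (fun l => exists best, nth (Num 0) l 0 = data_tail best /\
       ((exists c, (Q < 2 ^ c)%N /\ yes best (dyadic 1 0 c)) \/
        exists m i j, [/\ (M < m)%N, no (dyadic m i j) & yes best (dyadic m.+1 i j)]))
    ((\sum_(r <- trow :: rows) (size r + 1) + B + 2 * J + K + 8) *
      (data_size inst + 20 * (H + B + K) + 150)) (2 * J + K + 2).
Proof.
move=> inst Q J K yes_cons orc nolt QB.
have Q1 : (1 * dens2 (trow :: rows) <= 2 ^ B)%N by rewrite mul1n.
set S := (\sum_(r <- trow :: rows) (size r + 1))%N.
apply: runs_le.
  apply: runs_seq; apply: runs_assign => /=.
  apply: runs_seq; apply: runs_assign => /=.
  apply: (@runs_seq _ _ _ _ _ _ (20 + B.+1 * (4 * B + 30) + (2 * B + 20) +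
    (data_size inst + B + 40 +
    (2 * J + K + 4) * (data_size inst + 20 * (H + B.+1 + K) + 100))) _ (2 * J + K + 2)).
  (* Swapping the two halves of the instance makes the target one more row of the matrix, so a
     single loop collects all denominators. *)
  apply: runs_weaken; first exact: (@den_rows_runs O B (trow :: rows) 1 inst (Num 0) _ isT Q1).
  - move=> _ [row' ->]; rewrite mul1n -/Q.
    apply: runs_le.
      apply: runs_seq; apply: runs_assign => /=.
      apply: (@runs_seq _ _ _ _ _ _ (data_size inst + B + 40 +
        (2 * J + K + 4) * (data_size inst + 20 * (H + B.+1 + K) + 100)) _ (2 * J + K + 2)).
      apply: runs_weaken.
      + apply: (@pow_loop_runs _ B Q B.+1 0) => //.
        by apply: leq_ltn_trans QB _; rewrite ltn_exp2l.
      + move=> _ [c [-> Qc cB]].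
        apply: runs_le.
          apply: runs_seq; apply: runs_call => /=.
          apply: (@runs_seq _ _ _ _ _ ((2 * J + K + 4) *
            (data_size inst + 20 * (H + c + K) + 100) + 4) 4 (2 * J + K + 1) 0).
          have := orc 1%N 0%N c isT isT.
          rewrite expn0 muln1 => -[ya|[-> na]].
            have [d da] := yes_cons _ _ ya; rewrite da.
            apply: (@runs_le _ _ _ _ 4 0); [apply: runs_if => /=|lia|by []].
            apply: runs_assign => /=; apply: runs_le; [apply: runs_assign => /=|by []|by []].
            exists (Cons (Num (Posz 1)) d); split=> //; left; exists c.
            by rewrite -da.
          apply: runs_le; [apply: runs_if => /=| |exact: leqnn].
            apply: runs_weaken; [| |exact: leqnn|exact: leqnn].
              apply: (@search_runs O inst c H yes no yes_cons orc) => // a.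
              exact: nolt.
            move=> l [m [i [j [best [lb Mm nm ym]]]]].
            apply: runs_le; [apply: runs_assign|by []|by []].
            exists best; split; first by rewrite nth_set_nth -lb.
            by right; exists m, i, j.
          rewrite /=; lia.
        1,2: rewrite /= ?nat_bits1 ?nat_bits_exp; nia.
      + exact: leqnn.
      + exact: leqnn.
    1,2: rewrite /= ?nat_bits1; nia.
  - exact: leqnn.
  - exact: leqnn.
all: rewrite /= ?nat_bits1 -/S; nia.
Qed.

(** * Dyadic queries as encoded rationals *)

Lemma dyadic_gt0 m i j : (0 < m)%N -> 0 < dyadic m i j.
Proof. by move=> m0; rewrite divr_gt0 // ltr0n ?muln_gt0 ?expn_gt0 ?m0. Qed.

(** An odd [m] is coprime to [2 ^ j], and for [j > 0] the factor [2 ^ i] is 1; so the numbers that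
    the program computes are already the reduced numerator and denominator. *)
Lemma enc_rat_dyadic m i j : odd m -> (i == 0%N) || (j == 0%N) ->
  enc_rat (dyadic m i j) = Cons (Num (Posz (m * 2 ^ i)%N)) (Num (Posz (2 ^ j)%N)).
Proof.
move=> om ij.
have cop : coprime `|Posz (m * 2 ^ i)| `|Posz (2 ^ j)|.
  rewrite /=; case: j ij => [|j]; first by rewrite coprimen1.
  rewrite orbF => /eqP->; rewrite muln1 coprime_pexpr // coprime_sym.
  by rewrite coprime2n.
have e : dyadic m i j = (Posz (m * 2 ^ i))%:~R / (Posz (2 ^ j))%:~R by [].
rewrite /enc_rat e coprimeq_num // coprimeq_den //.
rewrite gtr0_sg ?mul1r ?ltz_nat ?expn_gt0 //.
by rewrite eqz_nat expn_eq0.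
Qed.

(** * Size of the instance *)

Definition mx_rows (n : nat) (A : 'M[rat]_n) : seq (seq rat) :=
  [seq [seq A i j | j <- enum 'I_n] | i <- enum 'I_n].
Definition cv_row (n : nat) (t : 'cV[rat]_n) : seq rat :=
  [seq t i ord0 | i <- enum 'I_n].

Lemma enc_instanceE (n : nat) (A : 'M[rat]_n) (t : 'cV[rat]_n) : enc_instance A t =
  Cons (enc_seq [seq enc_seq (map enc_rat r) | r <- mx_rows A])
       (enc_seq (map enc_rat (cv_row t))).
Proof.
rewrite /enc_instance /enc_mx /enc_vec /mx_rows /cv_row -!map_comp.
by congr (Cons (enc_seq _) _); apply: eq_map => i /=; rewrite -map_comp.
Qed.

Definition rows_size (rs : seq (seq rat)) : nat :=
  \sum_(r <- rs) \sum_(x <- r) rat_size x.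

Lemma cvp_sizeE n (A : 'M[rat]_n) (t : 'cV[rat]_n) :
  cvp_size A t = (n * n + n + rows_size (cv_row t :: mx_rows A))%N.
Proof.
rewrite /cvp_size /mx_size /rows_size /mx_rows /cv_row big_cons.
rewrite big_map big_enum big_map big_enum /= muln1.
have -> : (\sum_(i < n) \sum_(x <- [seq A i j | j <- enum 'I_n]) rat_size x
  = \sum_(i < n) \sum_(j < n) rat_size (A i j))%N.
  by apply: eq_bigr => i _; rewrite big_map big_enum.
have -> : (\sum_(i < n) \sum_(j < 1) rat_size (t i j) = \sum_(i < n) rat_size (t i ord0))%N.
  by apply: eq_bigr => i _; rewrite big_ord1.
by rewrite addnACA; congr (_ + _)%N; rewrite addnC.
Qed.

Lemma dens_le r : (dens r <= 2 ^ (\sum_(x <- r) rat_size x))%N.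
Proof.
rewrite /dens expn_sum; apply: leq_prod => x _.
apply: leq_trans (ltnW (ltn_nat_bits _)) _.
by rewrite leq_exp2l // /rat_size leq_addl.
Qed.

Lemma dens2_le rs : (dens2 rs <= 2 ^ rows_size rs)%N.
Proof. by rewrite /dens2 /rows_size expn_sum; apply: leq_prod => r _; exact: dens_le. Qed.

Lemma dens2_cvp_le n (A : 'M[rat]_n) (t : 'cV[rat]_n) :
  (dens2 (cv_row t :: mx_rows A) <= 2 ^ cvp_size A t)%N.
Proof. by apply: leq_trans (dens2_le _) _; rewrite leq_exp2l // cvp_sizeE leq_addl. Qed.

Lemma size_le_rat_size (r : seq rat) : (size r <= \sum_(x <- r) rat_size x)%N.
Proof. by rewrite -sum1_size; apply: leq_sum => x _; rewrite /rat_size -addnA leq_addr. Qed.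

Lemma data_size_row (r : seq rat) :
  (data_size (enc_seq (map enc_rat r)) <= 4 * (\sum_(x <- r) rat_size x) + 1)%N.
Proof.
elim: r => [|x r IH]; first by rewrite big_nil /= nat_bits0.
by rewrite big_cons /= /rat_size; move: IH; rewrite /rat_size; lia.
Qed.

Lemma data_size_rows (rs : seq (seq rat)) :
  (data_size (enc_seq [seq enc_seq (map enc_rat r) | r <- rs])
    <= 4 * rows_size rs + 2 * size rs + 1)%N.
Proof.
rewrite /rows_size; elim: rs => [|r rs IH]; first by rewrite big_nil /= nat_bits0.
by rewrite big_cons /=; have := data_size_row r; lia.
Qed.

Lemma data_size_instance n (A : 'M[rat]_n) (t : 'cV[rat]_n) : (0 < n)%N ->
  (data_size (enc_instance A t) <= 4 * cvp_size A t)%N.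
Proof.
move=> n0; rewrite enc_instanceE cvp_sizeE /=.
have := data_size_row (cv_row t); have := data_size_rows (mx_rows A).
have -> : size (mx_rows A) = n by rewrite size_map size_enum_ord.
rewrite /rows_size big_cons; nia.
Qed.

Lemma sum_size_rows n (A : 'M[rat]_n) (t : 'cV[rat]_n) :
  (\sum_(r <- cv_row t :: mx_rows A) (size r + 1) = (n + 1) * (n + 1))%N.
Proof.
rewrite /mx_rows /cv_row big_cons size_map size_enum_ord big_map big_enum /=.
under eq_bigr do rewrite size_map size_enum_ord.
by rewrite sum_nat_const card_ord; lia.
Qed.

Lemma rows_size_ge n (A : 'M[rat]_n) (t : 'cV[rat]_n) :
  (n * n + n <= rows_size (cv_row t :: mx_rows A))%N.
Proof.
apply: (@leq_trans (\sum_(r <- cv_row t :: mx_rows A) size r)); last first.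
  by apply: leq_sum => r _; exact: size_le_rat_size.
rewrite /mx_rows /cv_row big_cons size_map size_enum_ord big_map big_enum /=.
under eq_bigr do rewrite size_map size_enum_ord.
by rewrite sum_nat_const card_ord; lia.
Qed.

(** * Distances to the lattice *)

Lemma dvdn_dens (r : seq rat) x : x \in r -> (`|denq x| %| dens r)%N.
Proof.
rewrite /dens; elim: r => //= y r IH; rewrite inE big_cons => /orP[/eqP<-|/IH h].
  exact: dvdn_mulr.
exact: dvdn_mull.
Qed.

Lemma dvdn_dens2 (rs : seq (seq rat)) (r : seq rat) x :
  r \in rs -> x \in r -> (`|denq x| %| dens2 rs)%N.
Proof.
move=> + xr; rewrite /dens2; elim: rs => //= y rs IH; rewrite inE big_cons.
move=> /orP[/eqP<-|/IH h]; last exact: dvdn_mull.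
by apply: dvdn_mulr; exact: dvdn_dens.
Qed.

Lemma int_mul_den (Q : nat) (x : rat) : (`|denq x| %| Q)%N -> Q%:R * x \is a Num.int.
Proof.
move=> /dvdnP[k ->]; rewrite natrM -mulrA.
rewrite (_ : `|denq x|%:R * x = (numq x)%:~R); last first.
  by rewrite numqE mulrC -[in RHS]absz_denq.
by rewrite rpredM // ?intr_int // natr_int.
Qed.

Section Lattice.

Variables (n : nat) (A : 'M[rat]_n) (t : 'cV[rat]_n).
Let Q := dens2 (cv_row t :: mx_rows A).

Lemma den_gt0 : 0 < Q%:R :> rat.
Proof. by rewrite ltr0n dens2_gt0. Qed.

Lemma in_lattice0 : in_lattice A 0.
Proof. by exists 0; rewrite map_mx0 mulmx0. Qed.

Lemma int_mx_entry i j : Q%:R * A i j \is a Num.int.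
Proof.
apply: int_mul_den; apply: (@dvdn_dens2 _ [seq A i j | j <- enum 'I_n]).
  by rewrite inE; apply/orP; right; apply/mapP; exists i => //; rewrite mem_enum.
by apply/mapP; exists j => //; rewrite mem_enum.
Qed.

Lemma int_cv_entry i : Q%:R * t i ord0 \is a Num.int.
Proof.
apply: int_mul_den; apply: (@dvdn_dens2 _ (cv_row t)); first by rewrite inE eqxx.
by apply/mapP; exists i => //; rewrite mem_enum.
Qed.

(** The first alternative covers [n = 0], where no entry can attain the norm. *)
Lemma mx_norm_cases (v : 'cV[rat]_n) : `|v| = 0 \/ exists i, `|v| = `|v i ord0|.
Proof.
have [->|] := eqVneq `|v| 0; [by left|move=> v0; right].
by have [[i j] /= e] := mx_norm_neq0 v0; exists i; rewrite (ord1 j) in e.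
Qed.

(** [Q] is a multiple of every denominator in [A] and [t], so it makes each entry of [v - t] an
    integer. *)
Lemma lattice_dist_nat v : in_lattice A v -> exists N : nat, Q%:R * `|v - t| = N%:R.
Proof.
move=> [x ->]; set w := _ - t.
have wint i : Q%:R * w i ord0 \is a Num.int.
  rewrite !mxE mulrBr rpredB ?int_cv_entry // mulr_sumr rpred_sum // => j _.
  by rewrite mxE mulrA rpredM ?int_mx_entry // intr_int.
apply/natrP; have [->|[i ->]] := mx_norm_cases w; first by rewrite mulr0.
by rewrite -[X in X * _]ger0_norm ?(ltW den_gt0) // -normrM natr_norm_int.
Qed.

(** The distances scaled by [Q] are natural numbers, so the minimum exists by well-ordering, even
    for singular [A]. *)
Lemma closest_vector_exists : exists w, closest_vector A t w.
Proof.
pose P (k : nat) := `[< exists2 v, in_lattice A v & Q%:R * `|v - t| = k%:R >].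
have exP : exists k, P k.
  have [N hN] := lattice_dist_nat in_lattice0.
  by exists N; apply/asboolP; exists 0 => //; exact: in_lattice0.
case: (ex_minnP exP) => k /asboolP[w lw hw] mink; exists w; split=> // u lu.
have [N hN] := lattice_dist_nat lu.
rewrite -(ler_pM2l den_gt0) hw hN ler_nat; apply: mink.
by apply/asboolP; exists u.
Qed.

(** [Q] times the distance is a natural number at most [Q / 2 ^ c < 1]. *)
Lemma lattice_dist_small v c : in_lattice A v -> (Q < 2 ^ c)%N ->
  `|v - t| <= dyadic 1 0 c -> v = t.
Proof.
move=> lv Qc; have [N hN] := lattice_dist_nat lv.
rewrite /dyadic mul1n expn0 -(ler_pM2l den_gt0) hN => h.
have : N%:R < 1 :> rat.
  by apply: le_lt_trans h _; rewrite mul1r ltr_pdivrMr ?mul1r ?ltr_nat //.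
rewrite -[1]/(1%:R) ltr_nat ltnS leqn0 => /eqP N0.
move: hN; rewrite N0 => /eqP; rewrite mulf_eq0 (gt_eqF den_gt0) /= normr_eq0 subr_eq0.
by move/eqP.
Qed.

Lemma norm_target_le : `|0 - t| <= (2 ^ cvp_size A t)%:R.
Proof.
rewrite sub0r normrN; have [->|[i ->]] := mx_norm_cases t; first exact: ler0n.
set x := t i ord0.
have h1 : `|x| <= `|numq x|%:R.
  rewrite natr_absz intr_norm numqE normrM ler_peMr //.
  by rewrite ger0_norm ?ler0z // ler1z -gtz0_ge1 denq_gt0.
apply: le_trans h1 _; rewrite ler_nat.
apply: leq_trans (ltnW (ltn_nat_bits _)) _; rewrite leq_exp2l //.
rewrite /cvp_size /mx_size.
have : (rat_size x <= \sum_(i < n) \sum_(j < 1) rat_size (t i j))%N.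
  by rewrite (bigD1 i) //= big_ord1 leq_addr.
by rewrite /rat_size; lia.
Qed.

End Lattice.

(** * Correctness and complexity *)

Lemma gap_cvp_oracle_answers (R : realType) (alpha : R) O n (A : 'M[rat]_n)
    (t : 'cV[rat]_n) m i j :
  gap_cvp_oracle alpha O -> (0 < n)%N -> odd m -> (i == 0%N) || (j == 0%N) ->
  answers
    (fun a D => exists v, [/\ a = enc_found v, in_lattice A v & `|v - t| <= D])
    (fun D => forall v, in_lattice A v -> alpha^-1 * ratr D < ratr `|v - t|)
    (O (Cons (enc_instance A t)
          (Cons (Num (Posz (m * 2 ^ i)%N)) (Num (Posz (2 ^ j)%N)))))
    (dyadic m i j).
Proof.
move=> gap n0 om ij; rewrite -enc_rat_dyadic //.
by apply: gap => //; apply: dyadic_gt0; case: m om.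
Qed.

(** The lattice vector 0 is within [2 ^ b] of [t], where [b] is the encoding length. A refusal thus
    forces [2 ^ a / 2 ^ c < alpha * 2 ^ b <= 2 ^ (b + 1)]. *)
Lemma oracle_no_exponent (R : realType) (alpha : R) n (A : 'M[rat]_n)
    (t : 'cV[rat]_n) a c :
  0 < alpha <= 2 ->
  (forall v, in_lattice A v -> alpha^-1 * ratr (dyadic 1 a c) < ratr `|v - t|) ->
  (a < cvp_size A t + c + 1)%N.
Proof.
move=> /andP[al0 al2] /(_ _ (in_lattice0 A)); rewrite mulrC ltr_pdivrMr // => h.
have : ratr (dyadic 1 a c) < (2 ^ cvp_size A t)%:R * 2 :> R.
  apply: lt_le_trans h _; apply: ler_pM => //.
  - by rewrite ler0q.
  - exact: ltW.
  - by rewrite -(ratr_nat R) ler_rat norm_target_le.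
rewrite /dyadic mul1n fmorph_div /= !ratr_nat ltr_pdivrMr ?ltr0n ?expn_gt0 //.
rewrite -[2]/(2%:R) -!natrM ltr_nat -{3}(expn1 2) -!expnD ltn_exp2l //.
lia.
Qed.

(** With [D = eps / 5] and [P = m * u], the hypothesis on [m] says [u <= 2 * D * P]. Hence [d <= (1
    + 2 * D) * P <= (1 + 2 * D) * (1 + D) * r]. *)
Lemma approx_of_bracket (R : realType) (eps m u d r : R) :
  0 < eps < 1 -> 0 < u -> 5 <= 2 * eps * m ->
  (1 + eps / 5)^-1 * (m * u) < r -> d <= (m + 1) * u -> d <= (1 + eps) * r.
Proof.
move=> /andP[e0 e1] u0 em; rewrite mulrC ltr_pdivrMr; last by lra.
set D := eps / 5 => h hd.
have eD : eps = 5 * D by rewrite /D; field.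
have [D0 D1] : 0 < D /\ D < 1 by rewrite /D; lra.
have hu : 0 <= u * (2 * eps * m - 5) by rewrite mulr_ge0 ?subr_ge0 // ltW.
clearbody D; subst eps; set P := m * u in h *.
have {}hu : u <= 2 * D * P by rewrite /P; lra.
have P0 : 0 < P by rewrite -(pmulr_rgt0 _ D0); lra.
have r0 : 0 < r by rewrite -(pmulr_lgt0 _ (_ : 0 < 1 + D)); lra.
(* [h1] and [h2] conclude by [(1 + 5 * D) - (1 + 2 * D) * (1 + D) = 2 * D * (1 - D)]. *)
have h1 : 0 <= (1 + 2 * D) * (r * (1 + D) - P).
  by rewrite mulr_ge0 ?subr_ge0 ?(ltW h) //; lra.
have h2 : 0 <= D * r * (1 - D) by rewrite !mulr_ge0 ?subr_ge0 // ltW.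
have h3 : (m + 1) * u = P + u by rewrite /P; ring.
rewrite h3 in hd; lra.
Qed.

Lemma cvp_size_ge4 n (A : 'M[rat]_n) (t : 'cV[rat]_n) :
  (0 < n)%N -> (4 <= cvp_size A t)%N.
Proof. by move=> n0; have := rows_size_ge A t; rewrite cvp_sizeE; nia. Qed.

Lemma cvp_program_correct (R : realType) (eps : R) M O n (A : 'M[rat]_n)
    (t : 'cV[rat]_n) :
  0 < eps < 1 -> 5 <= 2 * eps * M.+1%:R -> (0 < n)%N ->
  gap_cvp_oracle (1 + eps / 5) O ->
  let b := cvp_size A t in let K := nat_bits M in
  exists (v : 'cV[rat]_n) (T k : nat),
    [/\ computes O (cvp_program M) (enc_instance A t) (enc_vec v) T k,
        approx_closest_vector eps A t v,
        (k <= 2 * up_log 2 (2 * b + 2) + K + 2)%N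
      & (T <= 1200 * (b + K) ^ 2)%N].
Proof.
move=> heps hM n0 gap b K; have [e0 e1] := andP heps.
have al : 0 < 1 + eps / 5 <= 2 by apply/andP; split; lra.
have ans m i j om ij := @gap_cvp_oracle_answers R _ O n A t m i j gap n0 om ij.
(* [2 * b + 2] is [b + c + 1] at the largest [c], namely [b + 1]. *)
have nolt c a : (c <= b.+1)%N -> (forall v, in_lattice A v ->
    (1 + eps / 5)^-1 * ratr (dyadic 1 a c) < ratr `|v - t|) -> (a < 2 * b + 2)%N.
  by move=> cb /(oracle_no_exponent al); rewrite -/b; lia.
have ycons a (D : rat) : (exists v, [/\ a = enc_found v, in_lattice A v & `|v - t| <= D]) ->
    exists d, a = Cons (Num (Posz 1)) d.
  by move=> [v [-> _ _]]; exists (enc_vec v).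
rewrite enc_instanceE in ans *.
have [l [T [k [ex [best [l0 res]] hT hk]]]] :=
  cvp_program_runs M ycons ans nolt (dens2_cvp_le A t).
have init : store_set (fun=> Num 0) 0 (Cons
    (enc_seq [seq enc_seq (map enc_rat r) | r <- mx_rows A])
    (enc_seq (map enc_rat (cv_row t)))) = st (Cons
    (enc_seq [seq enc_seq (map enc_rat r) | r <- mx_rows A])
    (enc_seq (map enc_rat (cv_row t))) :: nseq 9 (Num 0)).
  apply/funext => -[|y] //.
  by rewrite [RHS](_ : _ = nth (Num 0) (nseq 9 (Num 0)) y) // nth_nseq if_same.
have [w cw] := closest_vector_exists A t.
have [v [bv lv apx]] : exists v, [/\ best = enc_found v, in_lattice A v &
    ratr `|v - t| <= (1 + eps) * ratr `|w - t|].
  case: res => [[c [Qc [v [-> lv hv]]]]|[m [i [j [Mm hno [v [-> lv hv]]]]]]];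
    exists v; split=> //.
    (* A hit on the first query means [v = t], at distance 0. *)
    rewrite (lattice_dist_small lv Qc hv) subrr normr0 rmorph0.
    by rewrite mulr_ge0 ?ler0q //; lra.
  have u0 : 0 < ratr (dyadic 1 i j) :> R by rewrite ltr0q dyadic_gt0.
  have dm p : ratr (dyadic p i j) = p%:R * ratr (dyadic 1 i j) :> R.
    by rewrite -(ratr_nat R p) -rmorphM /dyadic mul1n natrM mulrA.
  apply: (@approx_of_bracket _ eps m%:R (ratr (dyadic 1 i j))) => //.
  - apply: le_trans hM _; rewrite ler_pM2l ?ler_nat //; lra.
  (* The refusal at the lower end, applied to the closest vector [w], bounds the minimum from
     below. *)
  - by rewrite -dm; apply: hno; case: cw.
  - by rewrite natr1 -dm ler_rat.
exists v, T, k; split.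
- by exists (st l); [rewrite init|rewrite /st l0 bv].
- by split=> //; exists w.
- exact: hk.
- apply: leq_trans hT _.
  rewrite -enc_instanceE sum_size_rows -/b -/K.
  have := data_size_instance A t n0; rewrite -/b.
  have := rows_size_ge A t; have := cvp_sizeE A t; rewrite -/b.
  have : (up_log 2 (2 * b + 2) <= 2 * b + 2)%N.
    by apply: up_log_min => //; apply: ltnW; exact: ltn_expl.
  set J := up_log _ _; set I := data_size _.
  move=> hJ hb hr hI.
  have b4 : (4 <= b)%N by nia.
  have h1 : ((n + 1) * (n + 1) <= b)%N by nia.
  (* The passes are at most [6 * b + K + 12] and the cost of each at most [64 * b + 20 * K + 190];
     [b >= 4] absorbs the constants. *)
  apply: (@leq_trans ((10 * (b + K)) * (112 * (b + K)))%N); last by nia.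
  by apply: leq_mul; lia.
Qed.

(** * Logarithmic bounds on calls and time *)

Lemma up_log2_le (R : realType) (x : nat) : (1 < x)%N ->
  (up_log 2 x)%:R * ln 2 <= ln x%:R + ln 2 :> R.
Proof.
move=> x1; have := up_log_gtn (isT : (1 < 2)%N) x1.
(* Here [up_log 2 x = k + 1] with [2 ^ k < x]; rounding up costs one [ln 2]. *)
have := up_log_gt0 2 x; rewrite x1 /=; case: up_log => // k _ /= h.
rewrite -natr1 mulrDl mul1r lerD2r mulr_natl -lnXn //.
rewrite -natrX ler_ln ?posrE ?ltr0n ?expn_gt0 ?ler_nat ?(ltnW h) //.
by apply: leq_trans x1.
Qed.

Lemma ln4 (R : realType) : ln 4 = 2 * ln 2 :> R.
Proof. by rewrite (_ : 4 = 2 ^+ 2) ?lnXn ?mulr_natl //; ring. Qed.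

(** [2 * b + 2 <= b ^ 2] gives two copies of [ln b], and the rounding term [ln 2] is below the
    third. *)
Lemma exponent_calls_le (R : realType) (b : nat) : (4 <= b)%N ->
  (up_log 2 (2 * b + 2))%:R * ln 2 <= 3 * ln b%:R :> R.
Proof.
move=> b4; have b0 : 0 < b%:R :> R by rewrite ltr0n; lia.
apply: le_trans (up_log2_le _ _) _; first by lia.
have : ln (2 * b + 2)%:R <= ln (b%:R ^+ 2) :> R.
  rewrite ler_ln ?posrE ?exprn_gt0 ?ltr0n ?addn_gt0 ?orbT //; last by lia.
  by rewrite -natrX ler_nat; nia.
have : ln 2 <= ln b%:R :> R by rewrite ler_ln ?posrE // ler_nat; lia.
by rewrite lnXn ?mulr2n //; lra.
Qed.

(** [M + 1 <= 5 / (2 * eps) + 1 <= 4 / eps] because [eps < 1]. *)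
Lemma bisect_calls_le (R : realType) (eps : R) M : 0 < eps < 1 ->
  M%:R <= 5 / (2 * eps) ->
  (nat_bits M)%:R * ln 2 <= ln 4 + ln eps^-1 + ln 2.
Proof.
move=> /andP[e0 e1] Mle.
have le0 : 0 <= ln eps^-1 by rewrite ln_ge0 // invf_ge1 // ltW.
have l2 : 0 < ln 2 :> R by rewrite ln_gt0 // ltr1n.
have [->|M0] := posnP M; first by rewrite nat_bits0 mul0r ln4; lra.
apply: le_trans (up_log2_le _ _) _ => //; rewrite lerD2r.
rewrite -lnM ?posrE ?invr_gt0 // ler_ln ?posrE ?mulr_gt0 ?invr_gt0 ?ltr0n //.
rewrite -natr1 ler_pdivlMr //.
move: Mle; rewrite ler_pdivlMr; lra.
Qed.

(** The factor 10 is 6 from [2 * J], 1 from [K], and 3 for the additive constants, absorbed by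
    [1 <= g * lb]. [P] leaves room for the constant of the time bound. *)
Lemma calls_bound (R : realFieldType) (g P lb ln le J K k : R) :
  0 <= g -> 0 <= P -> 0 <= ln -> 0 <= le -> 1 <= g * lb ->
  J <= g * (3 * lb) -> K <= g * (lb + le) + 1 -> k <= 2 * J + K + 2 ->
  k <= (10 * g + P) * (lb + ln + le).
Proof.
move=> g0 P0 ln0 le0 one Jle Kle hk.
have gle : 0 <= g * le by rewrite mulr_ge0.
have gln : 0 <= g * ln by rewrite mulr_ge0.
have lb0 : 0 <= lb by rewrite leNgt; apply/negP => lb0; nra.
have P1 : 0 <= P * (lb + ln + le) by rewrite mulr_ge0 // !addr_ge0.
rewrite mulrDl; lra.
Qed.

(** From [lb <= b] and [1 <= b] follows [b + K <= (2 + g) * (b + le)]. The summand [10 * g] comes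
    from the shared constant. *)
Lemma time_bound (R : realFieldType) (g c b lb le K T : R) :
  0 <= g -> 0 <= c -> 1 <= b -> 0 <= K -> lb <= b -> 0 <= le -> K <= g * (lb + le) + 1 ->
  T <= c * (b + K) ^+ 2 ->
  T <= (10 * g + c * (2 + g) ^+ 2) * (b + le) ^+ 2.
Proof.
move=> g0 c0 b1 K0 lbb le0 Kle hT; apply: le_trans hT _.
rewrite mulrDl -[c * _ * _]mulrA -exprMn.
have gb : g * lb <= g * b by rewrite ler_wpM2l.
have h : b + K <= (2 + g) * (b + le) by lra.
have h2 : c * (b + K) ^+ 2 <= c * ((2 + g) * (b + le)) ^+ 2.
  by rewrite ler_wpM2l // lerXn2r ?nnegrE ?(le_trans _ h) // addr_ge0 // (le_trans _ b1).
by apply: le_trans h2 _; rewrite lerDr mulr_ge0 ?sqr_ge0 ?mulr_ge0.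
Qed.

Theorem theorem3p4 (R : realType) :
  exists (C : R) (d : nat), forall eps : R, 0 < eps < 1 ->
    let delta : R := Num.min (eps / 5%:R) (1 / 2%:R) in
    exists P : cmd,
      forall O : data -> data, gap_cvp_oracle (1 + delta) O ->
      forall (n : nat) (A : 'M[rat]_n) (t : 'cV[rat]_n), (0 < n)%N ->
        let b : R := (cvp_size A t)%:R in
        exists (v : 'cV[rat]_n) (T k : nat),
          [/\ computes O P (enc_instance A t) (enc_vec v) T k,
              approx_closest_vector eps A t v,
              k%:R <= C * (ln b + ln n%:R + ln eps^-1)
            & T%:R <= C * (b + ln eps^-1) ^+ d].
Proof.
have l2 : 0 < ln 2 :> R by rewrite ln_gt0 // ltr1n.
set g : R := (ln 2)^-1.
have g0 : 0 < g by rewrite invr_gt0.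
(* The sum of the constants for calls and time, so that one [C] serves both; the time is
   quadratic. *)
exists (10 * g + 1200 * (2 + g) ^+ 2), 2%N => eps heps delta.
have [e0 e1] := andP heps.
have -> : delta = eps / 5 by apply: min_idPl; lra.
(* Any [m > M] makes the ratio [1 + 1 / m] at most [1 + 2 * eps / 5]. [M] depends on [eps] alone, so
   the program is fixed before the oracle and the instance. *)
pose M := Num.trunc (5 / (2 * eps)).
have x0 : 0 <= 5 / (2 * eps) by apply: divr_ge0; lra.
have /andP[Mle Mgt] := truncn_itv x0; rewrite -/M in Mle Mgt.
exists (cvp_program M) => O gap n A t n0 b.
have hM : 5 <= 2 * eps * M.+1%:R.
  by move/ltW: Mgt; rewrite ler_pdivrMr 1?mulrC //; lra.
have [v [T [k [cmp apx hk hT]]]] := cvp_program_correct A t heps hM n0 gap.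
exists v, T, k.
have b4 := cvp_size_ge4 A t n0.
have b4' : 4 <= b by rewrite -[4]/(4%:R) ler_nat.
have b0 : 0 < b by apply: lt_le_trans b4'.
(* This lets [ln b] absorb the constant [ln 4] of the bisection bound. *)
have lb : ln 4 <= ln b by rewrite ler_ln ?posrE.
have l4 := ln4 R.
have le0 : 0 <= ln eps^-1 by rewrite ln_ge0 // invf_ge1 // ltW.
have ln0 : 0 <= ln n%:R :> R by rewrite ln_ge0 // ler1n.
have lbb : ln b <= b by exact/ltW/ln_sublinear.
have hJ : (up_log 2 (2 * cvp_size A t + 2))%:R * ln 2 <= 3 * ln b.
  exact: exponent_calls_le.
have hK : (nat_bits M)%:R * ln 2 <= ln b + ln eps^-1 + ln 2.
  by apply: le_trans (bisect_calls_le heps Mle) _; lra.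
have gl : g * ln 2 = 1 by rewrite mulVf // gt_eqF.
have gM x y : x * ln 2 <= y -> x <= g * y.
  by rewrite -[x <= _](ler_pM2r l2) mulrAC gl mul1r.
have Kle : (nat_bits M)%:R <= g * (ln b + ln eps^-1) + 1.
  by have := gM _ _ hK; rewrite mulrDr gl.
have Jle : (up_log 2 (2 * cvp_size A t + 2))%:R <= g * (3 * ln b) by exact: gM.
have one : 1 <= g * ln b by rewrite -gl ler_pM2l //; lra.
have gle : 0 <= g * ln eps^-1 by rewrite mulr_ge0 // ltW.
split=> //.
- apply: (calls_bound (ltW g0) _ ln0 le0 one Jle Kle).
  + by apply: mulr_ge0; [exact: ler0n|exact: sqr_ge0].
  + by move: hk; rewrite -(ler_nat R) natrD natrD natrM.
- apply: (time_bound (ltW g0) _ _ _ lbb le0 Kle); rewrite ?ler0n //.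
  + by apply: le_trans b4'; rewrite ler1n.
  + by move: hT; rewrite -(ler_nat R) natrM natrX natrD.
Qed.
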